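(* Let $m \ge 1$ and let $a_i, b_i \ge 2$ be integers for $1 \le i \le m$. Let $\{(A_i, B_i)\}_{i=1}^m$ be a system of pairs of finite sets such that $A_i \cap B_i = \emptyset$ for every $1 \le i \le m$, $|A_i \cap B_j| = 1$ for every $1 \le i \ne j \le m$, and $|A_i| \le a_i$, $|B_i| \le b_i$ for every $1 \le i \le m$. Then \[ \sum_{i=1}^m \frac{1}{\binom{a_i + b_i}{a_i}} \le \frac{29}{30}. \] *)

(* Defs.v *)
From mathcomp Require Export all_boot all_order all_algebra.

(* Main.v *)
Require Import Defs.
From mathcomp Require Import all_boot all_order all_algebra.
From mathcomp Require Import all_fingroup.
From mathcomp Require Import ring lra zify.

(* After padding, [#|A i| = a i] and [#|B i| = b i]. In a uniformly random order of
   the ground set, the event "all of [A i] comes before all of [B i]" has probability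
   [1 / 'C(a i + b i, a i)], and these events are disjoint, so one has to show that
   with probability at least [1 / 30] none of them occurs. Deleting random points from
   either end of the order reduces this to systems with [#|B i0| = #|A j0| = 2].
   If [i0 != j0] and no pair has both sizes 2, write [B i0 = {u, v}], [A j0 = {q, u}];
   there are [z] in [B j0] and [y] in [A i0] such that [q, z < u < v, y], an event of
   probability [1 / 30], excludes all the others. If [A i0 = {p, q}] and
   [B i0 = {u, v}], at least two of the four orders [p < u < q < v], [q < v < p < u],
   [q < u < p < v], [p < v < q < u] each contribute [1 / 24 - 1 / 40 = 1 / 60]. *)

Set Implicit Arguments.
Unset Strict Implicit.
Unset Printing Implicit Defensive.
Import Order.TTheory GRing.Theory Num.Theory.
Local Open Scope ring_scope.

(** * Reciprocal binomial weights: recurrence and growth *)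

Definition weight (a b : nat) : rat := 'C(a + b, a)%:R^-1.

Lemma weightC a b : weight a b = weight b a.
Proof. by rewrite /weight -bin_sub ?leq_addr // addKn addnC. Qed.

Lemma weight0n b : weight 0 b = 1.
Proof. by rewrite /weight bin0 invr1. Qed.

Lemma weight_stepr a b :
  b.+1%:R * weight a b = (a + b.+1)%:R * weight a b.+1.
Proof.
have h := mul_bin_down (a + b.+1) a; rewrite addnS /= subSn ?leq_addr // addKn in h.
have p0 n : 'C(a + n, a)%:R != 0 :> rat by rewrite pnatr_eq0 -lt0n bin_gt0 leq_addr.
by apply/eqP; rewrite /weight eqr_div // -!natrM addnS h.
Qed.

(** Conditioning on the first point [x] of a random order of [X]: for [B] to come wholly before [A],
    [x] must avoid [A], and then [B :\ x] must come before [A]. The points of [B] all contribute the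
    same weight, which [weight_stepr] rewrites as a multiple of [weight #|A| #|B|]; the points
    outside [A :|: B] contribute [weight #|A| #|B|] itself. *)
Lemma weight_step (T : finType) (X A B : {set T}) :
  A \subset X -> B \subset X -> [disjoint A & B] -> B != set0 ->
  \sum_(x in X | x \notin A) weight #|A| #|B :\ x| = #|X|%:R * weight #|A| #|B|.
Proof.
move=> AX BX dAB B0.
rewrite (bigID (mem B)) /=.
have [b Eb] : exists b, #|B| = b.+1 by case: #|B| (card_gt0 B) B0 => [|b] <- // _; exists b.
rewrite (eq_bigl (mem B)); last first.
  move=> x /=; rewrite andbC andbA; case xB: (x \in B) => //=.
  by rewrite (subsetP BX) //= (disjointFl dAB).
rewrite (eq_bigr (fun=> weight #|A| b)); last first.
  by move=> x /= xB; move: Eb; rewrite (cardsD1 x) xB add1n => -[->].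
rewrite [X in _ + X](eq_bigr (fun=> weight #|A| #|B|)); last first.
  by move=> x /andP[_ xB]; congr weight; apply: eq_card => y; rewrite !inE; case: eqP => // ->; move: xB => /= /negPf->.
rewrite !sumr_const.
rewrite [X in _ + _ *+ X](eq_card (B := X :\: (A :|: B))); last first.
  by move=> x; rewrite !inE unfold_in /= negb_or; case: (x \in X); rewrite ?andbT ?andbF.
have c1 : #|X :\: (A :|: B)| = (#|X| - (#|A| + #|B|))%N.
  rewrite cardsDS ?subUset ?AX //; congr (_ - _)%N.
  by apply/eqP; rewrite -cardsUI; move: dAB; rewrite -setI_eq0 => /eqP->; rewrite cards0 addn0.
have c2 : (#|A| + #|B| <= #|X|)%N.
  rewrite -cardsUI; move: (dAB); rewrite -setI_eq0 => /eqP->.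
  by rewrite cards0 addn0 subset_leq_card // subUset AX.
rewrite c1; move: c2; rewrite Eb => c2.
rewrite -[_ *+ b.+1]mulr_natl -[_ *+ (_ - _)]mulr_natl.
by rewrite weight_stepr -mulrDl -natrD subnKC.
Qed.

(** Pascal's rule on both binomials gives a double induction. The constant 10 is ['C(5, 2)],
    attained when [c + d = 1]; for [c = d = 0] the ratio is only ['C(4, 2) = 6]. *)
Lemma weight_grow c d : (0 < c + d)%N -> 10%:R * weight c.+2 d.+2 <= weight c d.
Proof.
have key : (0 < c + d)%N -> (10 * 'C(c + d, c) <= 'C(c.+2 + d.+2, c.+2))%N.
  have base n : (10 <= 'C(2 + n.+3, 2))%N.
    by rewrite bin2; apply: leq_trans (_ : ('C(5, 2) <= _)%N) => //; rewrite -bin2; apply: leq_bin2l.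
  elim: c d => [|c IHc] d; first by case: d => // d _; rewrite bin0 muln1.
  elim: d => [|d IHd] _.
    rewrite addn0 binn muln1 -bin_sub ?leq_addr // addKn addnC; exact: base.
  have -> : 'C(c.+1 + d.+1, c.+1) = ('C(c.+1 + d, c.+1) + 'C(c + d.+1, c))%N.
    by rewrite addnS binS addSnnS.
  have -> : 'C(c.+3 + d.+3, c.+3) = ('C(c.+3 + d.+2, c.+3) + 'C(c.+2 + d.+3, c.+2))%N.
    by rewrite addnS binS addSnnS.
  by rewrite mulnDr leq_add ?IHd ?IHc // ?addnS.
move=> /key h; rewrite /weight.
have p0 : 0 < ('C(c + d, c))%:R :> rat by rewrite ltr0n bin_gt0 leq_addr.
have q0 : 0 < ('C(c.+2 + d.+2, c.+2))%:R :> rat by rewrite ltr0n bin_gt0 leq_addr.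
rewrite ler_pdivrMr // mulrC ler_pdivlMr // -natrM ler_nat; exact: h.
Qed.

Lemma one_max3 (i j k : nat) : i != j -> j != k -> i != k ->
  (((i < k) && (j < k)) + ((k < i) && (j < i)) + ((i < j) && (k < j)) = 1)%N.
Proof. by case: (ltngtP i j); case: (ltngtP j k); case: (ltngtP i k) => //=; lia. Qed.

(** * Uniformly random orders of a finite set *)

Section RandomOrder.
Variable T : finType.
Implicit Types (X A B : {set T}) (f g : seq T -> rat) (s : seq T) (x y : T).

(* The expectation of [f] over a uniformly random sequence obtained by drawing
   [n] elements of [X] without replacement; only meaningful for [n = #|X|]. *)
Fixpoint avg (n : nat) X f : rat :=
  if n is n'.+1
  then (\sum_(x in X) avg n' (X :\ x) (fun s => f (x :: s))) / n%:R
  else f [::].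

Lemma eq_avg n X f g : f =1 g -> avg n X f = avg n X g.
Proof.
elim: n X f g => [|n IHn] X f g fg //=; congr (_ / _).
by apply: eq_bigr => x _; apply: IHn => s.
Qed.

Lemma avgD n X f g : avg n X (fun s => f s + g s) = avg n X f + avg n X g.
Proof.
elim: n X f g => [|n IHn] X f g //=; rewrite -mulrDl -big_split /=.
by congr (_ / _); apply: eq_bigr => x _; rewrite IHn.
Qed.

Lemma avgZ n X c f : avg n X (fun s => c * f s) = c * avg n X f.
Proof.
elim: n X f => [|n IHn] X f //=; rewrite mulrA mulr_sumr.
by congr (_ / _); apply: eq_bigr => x _; rewrite IHn.
Qed.

Lemma avg0 n X : avg n X (fun=> 0) = 0.
Proof. by rewrite (eq_avg n X (g := fun=> 0 * 0)) ?avgZ ?mul0r // => s; rewrite mul0r. Qed.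

Lemma avg_sum n X (I : Type) (r : seq I) (P : pred I) (F : I -> seq T -> rat) :
  avg n X (fun s => \sum_(i <- r | P i) F i s) = \sum_(i <- r | P i) avg n X (F i).
Proof.
elim: r => [|i r IHr].
  by rewrite big_nil (eq_avg n X (g := fun=> 0)) ?avg0 // => s; rewrite big_nil.
rewrite big_cons -IHr; case Pi: (P i); rewrite -?avgD;
  by apply: eq_avg => s; rewrite big_cons Pi.
Qed.

Lemma avg1 n X : #|X| = n -> avg n X (fun=> 1) = 1.
Proof.
elim: n X => [|n IHn] X cX //=.
rewrite (eq_bigr (fun=> 1)) ?sumr_const ?cX ?mulfV ?pnatr_eq0 // => x xX.
by rewrite IHn //; apply/eqP; rewrite -eqSS -cX (cardsD1 x X) xX.
Qed.

Lemma le_avg n X f g :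
  #|X| = n -> (forall s, s =i X -> f s <= g s) -> avg n X f <= avg n X g.
Proof.
elim: n X f g => [|n IHn] X f g cX fg /=.
  by apply: fg; rewrite (cards0_eq cX) => x; rewrite inE.
rewrite ler_pM2r ?invr_gt0 ?ltr0Sn //; apply: ler_sum => x xX.
apply: IHn => [|s sX]; first by apply/eqP; rewrite -eqSS -cX (cardsD1 x X) xX.
by apply: fg => y; rewrite !inE sX !inE; case: eqP => // ->.
Qed.

Lemma avg_map n X f (h : T -> T) :
  injective h -> avg n X (fun s => f (map h s)) = avg n (h @: X) f.
Proof.
move=> hI; elim: n X f => [|n IHn] X f //=; congr (_ / _).
rewrite big_imset /=; last by move=> x y _ _ /hI.
apply: eq_bigr => x xX; rewrite (IHn _ (fun s => f (h x :: s))).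
congr (avg _ _ _); apply/setP => y; rewrite !inE.
apply/imsetP/andP => [[z]|[yx /imsetP[z zX zy]]].
  by rewrite !inE => /andP[zx zX] ->; rewrite (inj_eq hI) zx imset_f.
by exists z; rewrite // !inE zX andbT; apply: contra_neq yx => <-.
Qed.

(** A point absent from [s] has index [size s], so it counts as coming after every point present. *)
Definition before x y s := (index x s < index y s)%N.

Definition precedes A B s := [forall x in A, forall y in B, before x y s].

Lemma precedesP A B s :
  reflect {in A & B, forall x y, before x y s} (precedes A B s).
Proof.
apply: (iffP forall_inP) => [h x y xA yB|h x xA]; last by apply/forall_inP => y; apply: h.
exact: (forall_inP (h x xA)).
Qed.

Lemma before_asym x y s : before x y s -> ~~ before y x s.
Proof. by rewrite /before -leqNgt => /ltnW. Qed.

Lemma before_trans y x z s : before x y s -> before y z s -> before x z s.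
Proof. exact: ltn_trans. Qed.

Lemma before_total x y s : x \in s -> x != y -> ~~ before x y s -> before y x s.
Proof.
rewrite /before -leqNgt leq_eqVlt => xs xy /orP[/eqP e|//].
by case/eqP: xy; rewrite -(nth_index x xs) -e nth_index // -index_mem e index_mem.
Qed.

(** Induction on the first drawn point [x]. If [A] is nonempty and [x] lies in [B], the event fails;
    otherwise it becomes the event for [A :\ x] and [B]. Summing over [x] is [weight_step] with the
    roles of [A] and [B] exchanged, hence the uses of [weightC]. *)
Lemma avg_precedes n X A B :
  #|X| = n -> A \subset X -> B \subset X -> [disjoint A & B] ->
  avg n X (fun s => (precedes A B s)%:R) = weight #|A| #|B|.
Proof.
elim: n X A B => [|n IHn] X A B cX AX BX dAB.
  move: AX BX; rewrite (cards0_eq cX) !subset0 => /eqP-> /eqP->.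
  rewrite cards0 weight0n /=; suff -> : precedes set0 set0 [::] by [].
  by apply/precedesP => x y; rewrite inE.
have [->|A0] := eqVneq A set0.
  rewrite cards0 weight0n -[RHS](avg1 cX); apply: eq_avg => s.
  suff -> : precedes set0 B s by [].
  by apply/precedesP => x y; rewrite inE.
have cX' x : x \in X -> #|X :\ x| = n.
  by move=> xX; apply/eqP; rewrite -eqSS -cX (cardsD1 x X) xX.
rewrite /= (bigID (mem B)) /= big1 ?add0r => [|x /andP[_ xB]]; last first.
  rewrite -[RHS](avg0 n (X :\ x)); apply: eq_avg => s.
  suff -> : precedes A B (x :: s) = false by [].
  have [a aA] := set0Pn _ A0.
  by apply/precedesP => /(_ _ _ aA xB); rewrite /before /= eqxx.
rewrite (eq_bigr (fun x => weight #|B| #|A :\ x|)) => [|x /andP[xX xB]]; last first.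
  rewrite weightC -(IHn (X :\ x)) ?cX' ?setSD //; last 2 first.
  - by rewrite subsetD1 BX xB.
  - by apply: disjointWl dAB; rewrite subsetDl.
  apply: eq_avg => s; congr (_%:R); congr nat_of_bool.
  have xNB y : y \in B -> x == y = false by move=> yB; apply: contraNF xB => /eqP->.
  apply/precedesP/precedesP => h a b.
    rewrite !inE => /andP[ax aA] bB; have := h a b aA bB.
    by rewrite /before /= (xNB b bB) eq_sym (negPf ax) ltnS.
  move=> aA bB; rewrite /before /= (xNB b bB); case: eqP => // ax.
  by rewrite ltnS; apply: h => //; rewrite !inE aA andbT eq_sym; apply/eqP.
rewrite weight_step // 1?disjoint_sym // cX weightC mulrC mulKf //.
by rewrite pnatr_eq0.
Qed.

Definition expect f := avg #|T| [set: T] f.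

Lemma le_expect f g : (forall s, (forall x, x \in s) -> f s <= g s) -> expect f <= expect g.
Proof.
by move=> fg; apply: le_avg => [|s sT]; rewrite ?cardsT //; apply: fg => x; rewrite sT inE.
Qed.

Lemma eq_expect f g : (forall s, (forall x, x \in s) -> f s = g s) -> expect f = expect g.
Proof. by move=> fg; apply: le_anti; rewrite !le_expect // => s /fg ->. Qed.

Lemma expect_precedes A B :
  [disjoint A & B] -> expect (fun s => (precedes A B s)%:R) = weight #|A| #|B|.
Proof. by move=> dAB; rewrite /expect avg_precedes ?subsetT ?cardsT. Qed.

Lemma expect_tperm x y f : expect (fun s => f (map (tperm x y) s)) = expect f.
Proof.
rewrite /expect avg_map; last exact: perm_inj.
by congr (avg _ _ _); apply/setP => z; rewrite [RHS]inE -[z](tpermK x y) imset_f ?inE.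
Qed.

Lemma before_tperm x y u v s :
  before u v (map (tperm x y) s) = before (tperm x y u) (tperm x y v) s.
Proof.
by rewrite /before -{1}(tpermK x y u) -{1}(tpermK x y v) !index_map //; apply: perm_inj.
Qed.

(* [x] and [y] are exchangeable for the event [P], so each comes first half the time. *)
Lemma expect_before (P : pred (seq T)) x y :
    x != y -> (forall s, P (map (tperm x y) s) = P s) ->
  expect (fun s => (P s && before x y s)%:R) = expect (fun s => (P s)%:R) / 2%:R.
Proof.
move=> xy Psym.
have -> : expect (fun s => (P s)%:R) =
    expect (fun s => (P s && before x y s)%:R) + expect (fun s => (P s && before x y s)%:R).
  rewrite -[X in _ = _ + X](expect_tperm x y) -avgD; apply: eq_expect => s sT.
  rewrite Psym before_tperm tpermL tpermR; case: (P s) => /=; last by rewrite addr0.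
  case: (boolP (before x y s)) => [xys|/(before_total (sT x) xy) ->]; last by rewrite add0r.
  by rewrite (negPf (before_asym xys)) addr0.
by field.
Qed.

Lemma precedes_tperm A B x y s :
    (x \in A) = (y \in A) -> (x \in B) = (y \in B) ->
  precedes A B (map (tperm x y) s) = precedes A B s.
Proof.
move=> xyA xyB.
have tA z : (tperm x y z \in A) = (z \in A) by case: tpermP => // ->.
have tB z : (tperm x y z \in B) = (z \in B) by case: tpermP => // ->.
apply/precedesP/precedesP => h a b aA bB; last by rewrite before_tperm h ?tA ?tB.
by rewrite -(tpermK x y a) -(tpermK x y b) -before_tperm h ?tA ?tB.
Qed.

(** Transposing [p] with [u], or [q] with [v], preserves [precedes A B], and transposing [q] with
    [v] does not affect the order of [p] and [u]. So [expect_before] applies twice, each time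
    halving. *)
Lemma expect_precedes_pairs A B p u q v :
    [disjoint A & B] -> p \in A -> u \in A -> p != u -> q \in B -> v \in B -> q != v ->
  expect (fun s => [&& precedes A B s, before p u s & before q v s]%:R) =
  weight #|A| #|B| / 4%:R.
Proof.
move=> dAB pA uA pu qB vB qv.
have nB x : x \in A -> x \in B = false by move/(disjointFr dAB).
have nA x : x \in B -> x \in A = false by move/(disjointFl dAB).
rewrite (eq_expect (g := fun s => ((precedes A B s && before p u s) && before q v s)%:R));
  last by move=> s _; rewrite andbA.
have dif a b : a \in A -> b \in B -> b != a.
  by move=> aA bB; apply: contraTneq bB => ->; rewrite nB.
rewrite (expect_before (P := fun s => precedes A B s && before p u s)) // => [|s]; last first.
  rewrite precedes_tperm ?nA ?qB ?vB // before_tperm.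
  by rewrite !tpermD // dif.
rewrite expect_before // => [|s]; last by rewrite precedes_tperm ?pA ?uA ?nB.
by rewrite expect_precedes //; field.
Qed.

(** The event says that [q], [z], [u] all come before [v] and [y], of probability
    [weight 3 2 = 1 / 10], and that [u] is the last of the first three, of conditional probability
    1/3 by symmetry. *)
Lemma expect_fork q z u v y :
  uniq [:: q; z; u; v; y] ->
  expect (fun s => [&& before q u s, before z u s, before u v s & before u y s]%:R)
  = 1 / 30%:R.
Proof.
rewrite /= !inE !negb_or andbT.
case/and4P=> /and4P[qz qu qv qy] /and3P[zu zv zy] /andP[uv uy] vy.
pose G s := precedes [set q; z; u] [set v; y] s.
pose L a b c s := [&& G s, before a c s & before b c s].
have Gsym a b s : a \in [set q; z; u] -> b \in [set q; z; u] -> G (map (tperm a b) s) = G s.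
  have nB c : c \in [set q; z; u] -> c \notin [set v; y].
    by rewrite !inE => /orP[/orP[]|] /eqP->; rewrite negb_or ?qv ?qy ?zv ?zy ?uv ?uy.
  by move=> aA bA; rewrite /G precedes_tperm ?aA ?bA // !(negPf (nB _ _)).
(* [L a b c] singles out [c] as the last of the three; a transposition moving [u] carries each
   choice of last point to the choice of [u]. *)
have L1 : expect (fun s => (L u z q s)%:R) = expect (fun s => (L q z u s)%:R).
  rewrite -[RHS](expect_tperm q u); apply: eq_expect => s _.
  by rewrite /L Gsym ?inE ?eqxx ?orbT // !before_tperm tpermL tpermR tpermD // eq_sym.
have L2 : expect (fun s => (L q u z s)%:R) = expect (fun s => (L q z u s)%:R).
  rewrite -[RHS](expect_tperm z u); apply: eq_expect => s _.
  by rewrite /L Gsym ?inE ?eqxx ?orbT // !before_tperm tpermL tpermR tpermD // eq_sym.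
have Gsum : expect (fun s => (G s)%:R) = expect (fun s => (L q z u s)%:R) +
    expect (fun s => (L u z q s)%:R) + expect (fun s => (L q u z s)%:R).
  rewrite -!avgD; apply: eq_expect => s sT; rewrite /L; case: (G s) => //=.
  rewrite -!natrD /before one_max3 //; apply/negP => /eqP.
  - by move/(index_inj u (sT q) (sT _)); apply/eqP.
  - by move/(index_inj u (sT z) (sT _)); apply/eqP.
  - by move/(index_inj u (sT q) (sT _)); apply/eqP.
have GE : expect (fun s => (G s)%:R) = 1 / 10%:R.
  rewrite expect_precedes; last first.
    rewrite disjoints_subset; apply/subsetP => x.
    by rewrite !inE => /orP[/orP[]|] /eqP->; rewrite negb_or ?qv ?qy ?zv ?zy ?uv ?uy.
  have -> : #|[set q; z; u]| = 3 by rewrite setUC cardsU1 cards2 !inE ![u == _]eq_sym (negPf qu) (negPf zu) qz.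
  by rewrite cards2 vy.
have -> : expect (fun s => [&& before q u s, before z u s, before u v s & before u y s]%:R)
    = expect (fun s => (L q z u s)%:R).
  apply: eq_expect => s _; congr (_%:R); congr nat_of_bool; rewrite /L /G.
  apply/and4P/and3P => [[h1 h2 h3 h4]|[/precedesP h h1 h2]].
    split=> //; apply/precedesP => a b; rewrite !inE.
    case/orP => [/orP[]|] /eqP->; case/orP=> /eqP-> //;
      by [exact: before_trans h1 h3 | exact: before_trans h1 h4
         | exact: before_trans h2 h3 | exact: before_trans h2 h4].
  by split=> //; apply: h; rewrite !inE eqxx ?orbT.
by move: Gsum; rewrite L1 L2 GE; lra.
Qed.

End RandomOrder.

(** * Crossing systems and the disjointness of their events *)

Lemma sum_indicator (J : finType) (I : {set J}) (E : pred J) :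
  {in I &, forall i j, E i -> E j -> i = j} ->
  \sum_(i in I) (E i)%:R = [exists i in I, E i]%:R :> rat.
Proof.
move=> uE; case: exists_inP => [[i iI Ei]|nE].
  rewrite (bigD1 i) //= Ei big1 ?addr0 // => j /andP[jI ji].
  by case Ej: (E j) => //; rewrite (uE i j) ?eqxx // in ji.
by rewrite big1 // => i iI; case Ei: (E i) => //; case: nE; exists i.
Qed.

Section CrossingSystems.
Variables (T J : finType).
Implicit Types (I : {set J}) (A B : J -> {set T}) (s : seq T).

(** Nonempty intersections suffice to make the events disjoint. Unlike [one_crossing], this can
    still be checked for the stripped sets in [increasing4_avoids]. *)
Definition cross_intersecting I A B :=
  {in I, forall i, [disjoint A i & B i]} /\
  {in I &, forall i j, i != j -> A i :&: B j != set0}.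

Definition avoids I A B s := [forall i in I, ~~ precedes (A i) (B i) s].

(** For [i != j], a point of [A i :&: B j] and a point of [A j :&: B i] would have to come in both
    orders if the events of [i] and [j] both occurred. So the events are disjoint, and [avoids] is
    the complement of their union. *)
Lemma sum_weight_avoids I A B :
  cross_intersecting I A B ->
  \sum_(i in I) weight #|A i| #|B i| + expect (fun s => (avoids I A B s)%:R) = 1.
Proof.
move=> [dAB xAB].
rewrite (eq_bigr (fun i => expect (fun s => (precedes (A i) (B i) s)%:R))); last first.
  by move=> i iI; rewrite expect_precedes ?dAB.
rewrite -avg_sum -avgD -[RHS](@avg1 T #|T| [set: T]) ?cardsT //.
apply: eq_avg => s; rewrite sum_indicator => [|i j iI jI /precedesP Ei /precedesP Ej].
  rewrite /avoids -negb_exists_in; by case: [exists _ in _, _].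
apply/eqP; apply: contraT => ij.
have /set0Pn[x] := xAB i j iI jI ij; rewrite inE => /andP[xi xj].
have /set0Pn[y] : A j :&: B i != set0 by apply: xAB; rewrite // eq_sym.
rewrite inE => /andP[yj yi].
by have := before_asym (Ei x y xi yi); rewrite Ej.
Qed.

Lemma sum_weight_le1 I A B :
  cross_intersecting I A B -> \sum_(i in I) weight #|A i| #|B i| <= 1.
Proof.
move=> /sum_weight_avoids <-; rewrite lerDl.
rewrite -(avg0 #|T| [set: T]); apply: le_expect => s _; exact: ler0n.
Qed.

Definition one_crossing I A B :=
  {in I, forall i, [disjoint A i & B i]} /\
  {in I &, forall i j, i != j -> #|A i :&: B j| = 1%N}.

Lemma one_crossing_cross I A B : one_crossing I A B -> cross_intersecting I A B.
Proof.
by move=> [dAB xAB]; split=> // i j iI jI ij; rewrite -card_gt0 xAB.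
Qed.

Lemma card_setI2 (S : {set T}) u v :
  u != v -> #|S :&: [set u; v]| = 1%N -> (u \in S) = (v \notin S).
Proof.
move=> uv; rewrite (cardsD1 u) (cardsD1 v) !inE !eqxx [v == u]eq_sym uv orbT !andbT.
have -> : S :&: [set u; v] :\ u :\ v = set0.
  by apply/setP => x; rewrite !inE; case: eqP; case: eqP; rewrite ?andbF.
by rewrite cards0; case: (u \in S); case: (v \in S).
Qed.

(** * Systems in which some [B i0] and some [A j0] have size 2 *)

Definition increasing4 (p u q v : T) s := [&& before p u s, before u q s & before q v s].

(** The chain amounts to [{p, u}] before [{q, v}] with each pair in order, whence
    [weight 2 2 / 4 = 1 / 24]. *)
Lemma expect_increasing4 p u q v :
  uniq [:: p; u; q; v] -> expect (fun s => (increasing4 p u q v s)%:R) = 1 / 24%:R.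
Proof.
rewrite /= !inE !negb_or andbT => /and3P[/and3P[pu pq pv] /andP[uq uv] qv].
rewrite (eq_expect (g := fun s =>
  [&& precedes [set p; u] [set q; v] s, before p u s & before q v s]%:R)).
  rewrite expect_precedes_pairs ?inE ?eqxx ?orbT // ?cards2 ?pu ?qv //.
  rewrite disjoints_subset; apply/subsetP => x; rewrite !inE negb_or.
  by case/orP => /eqP->; apply/andP.
move=> s _; congr (_%:R); congr nat_of_bool.
apply/and3P/and3P => -[].
  rewrite /before => h1 h2 h3; split=> //; apply/precedesP => x y.
  by rewrite !inE => /orP[] /eqP-> /orP[] /eqP->; rewrite /before; lia.
by move=> /precedesP h ? ?; split=> //; apply: h; rewrite !inE eqxx ?orbT.
Qed.

(* Against the order [p < u < q < v], only the pairs with [u] in [A i] and [q] in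
   [B i] compete. Stripping [p], [u], [q], [v] from them leaves a cross-intersecting
   system, whose total weight is at most 1, while completing them to contain all four
   points divides their weight by at least 10. *)
Lemma increasing4_avoids I A B i0 p u q v :
    one_crossing I A B ->
    {in I, forall i, (2 <= #|A i|)%N} -> {in I, forall i, (2 <= #|B i|)%N} ->
    i0 \in I -> A i0 = [set p; q] -> B i0 = [set u; v] -> p != q -> u != v ->
    {in I, forall i, A i = [set p; u] -> B i = [set q; v] -> False} ->
  1 / 60%:R <= expect (fun s => (increasing4 p u q v s && avoids I A B s)%:R).
Proof.
move=> [dAB xAB] sA sB i0I A0 B0 pq uv noperf.
have [pu pv qu qv] : [/\ p != u, p != v, q != u & q != v].
  have nB x : x \in [set p; q] -> x \notin [set u; v].
    by rewrite -A0 -B0 => xA; rewrite (disjointFr (dAB _ i0I) xA).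
  move: (nB p) (nB q); rewrite !inE !eqxx orbT !negb_or => h1 h2.
  by case/andP: (h1 isT) => -> ->; case/andP: (h2 isT) => -> ->.
pose I' := [set i in I | [&& u \in A i, q \in B i, v \notin A i & p \notin B i]].
pose C i := A i :\: [set p; u]; pose D i := B i :\: [set q; v].
pose E i s := [&& precedes ([set p; u] :|: C i) ([set q; v] :|: D i) s,
  before p u s & before q v s].
have I'P i : i \in I' -> [/\ i \in I, u \in A i, q \in B i, v \notin A i & p \notin B i].
  by rewrite inE => /andP[-> /and4P[-> -> -> ->]].
have notA i x : i \in I -> x \in B i -> x \notin A i.
  by move=> iI xB; rewrite (disjointFl (dAB i iI)).
have notB i x : i \in I -> x \in A i -> x \notin B i.
  by move=> iI xA; rewrite (disjointFr (dAB i iI)).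
have crossCD : cross_intersecting I' C D.
  split=> [i /I'P[iI _ _ _ _]|i j /I'P[iI uAi qBi vAi pBi] /I'P[jI uAj qBj vAj pBj] ij].
    by apply: disjointW (dAB i iI); rewrite subsetDl.
  have /set0Pn[x] : A i :&: B j != set0 by rewrite -card_gt0 xAB.
  (* The common point of [A i] and [B j] survives the stripping: [p] and [u] are not in [B j], while
     [q] and [v] are not in [A i]. *)
  rewrite inE => /andP[xA xB]; apply/set0Pn; exists x; rewrite !inE xA xB !negb_or !andbT.
  apply/and3P; split; first apply/andP; first split.
  - by apply: contraNneq pBj => <-.
  - by apply: contraTneq uAj => <-; apply: notA.
  - by apply: contraTneq qBi => <-; apply: notB.
  - by apply: contraNneq vAi => <-.
have weightE i : i \in I' ->
    expect (fun s => (E i s)%:R) <= weight #|C i| #|D i| / 40%:R.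
  move=> /I'P[iI uA qB vA pB].
  rewrite expect_precedes_pairs ?inE ?eqxx ?orbT //; last first.
    rewrite disjoints_subset; apply/subsetP => x.
    rewrite !inE; case: (x =P p) => [->|_] /=; first by rewrite (negPf pq) (negPf pv) (negPf pB) !andbF.
    case: (x =P u) => [->|_] /=.
      by rewrite eq_sym (negPf qu) (negPf uv) (negPf (notB _ _ iI uA)) andbF.
    move=> xA; rewrite (negPf (notB _ _ iI xA)) andbF orbF negb_or.
    apply/andP; split; first by apply: contraTneq qB => <-; apply: notB.
    by apply: contraNneq vA => <-.
  have cU (x y : T) (S : {set T}) : x != y -> #|[set x; y] :|: S :\: [set x; y]| = (#|S :\: [set x; y]|).+2.
    move=> xy; rewrite -[LHS]addn0 -(cards0 T).
    have <- : [set x; y] :&: (S :\: [set x; y]) = set0.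
      by apply/setP => z; rewrite !inE; case: (z == x); case: (z == y).
    by rewrite cardsUI cards2 xy.
  rewrite !cU //.
  suff h : (0 < #|C i| + #|D i|)%N by have := weight_grow h; rewrite /C /D; lra.
  (* If both stripped sets were empty, the lower bounds on the sizes would force [A i = {p, u}] and
     [B i = {q, v}], which [noperf] excludes. *)
  rewrite lt0n addn_eq0; apply/negP => /andP[]; rewrite !cards_eq0 !setD_eq0 => AC BD.
  apply: (noperf i iI).
    by apply/eqP; rewrite eqEcard AC cards2 pu sA.
  by apply/eqP; rewrite eqEcard BD cards2 qv sB.
have bound : expect (fun s => \sum_(i in I') (E i s)%:R) <= 1 / 40%:R.
  rewrite /expect avg_sum; apply: le_trans (ler_sum _ weightE) _.
  by have := sum_weight_le1 crossCD; rewrite -mulr_suml; lra.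
(* When the chain holds, either no event of the system occurs or some [E i] with [i] in [I'] does;
   this leaves at least [1 / 24 - 1 / 40 = 1 / 60]. *)
have : expect (fun s => (increasing4 p u q v s)%:R) <=
       expect (fun s => (increasing4 p u q v s && avoids I A B s)%:R)
       + expect (fun s => \sum_(i in I') (E i s)%:R).
  rewrite -avgD; apply: le_expect => s sT.
  case inc: (increasing4 p u q v s); last by rewrite add0r sumr_ge0.
  have E0 : 0 <= \sum_(i in I') (E i s)%:R :> rat by apply: sumr_ge0 => i _; apply: ler0n.
  case: (boolP (avoids _ _ _ _)) => [_|]; first by rewrite lerDl.
  rewrite /avoids negb_forall_in => /exists_inP[i iI /negPn Ei]; rewrite add0r.
  case/and3P: inc => b1 b2 b3.
  have /precedesP Ei' := Ei.
  have ii0 : i != i0.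
    apply/eqP => ie; have := Ei' q u; rewrite ie A0 B0 !inE !eqxx !orbT => /(_ isT isT).
    by rewrite (negPf (before_asym b2)).
  (* Crossing with the pair [i0]: [A i] contains exactly one of [u], [v], and [B i] exactly one of
     [p], [q]. As [v] is last and [p] is first in the chain, these must be [u] and [q]. *)
  have uvA : (u \in A i) = (v \notin A i) by apply: card_setI2; rewrite // -B0 xAB.
  have pqB : (p \in B i) = (q \notin B i).
    by apply: card_setI2; rewrite // -A0 setIC xAB // eq_sym.
  have uA : u \in A i.
    rewrite uvA; apply/negP => vA; case: (boolP (p \in B i)).
      by move/(Ei' v p vA); rewrite (negPf (before_asym (before_trans (before_trans b1 b2) b3))).
    by rewrite pqB negbK => /(Ei' v q vA); rewrite (negPf (before_asym b3)).
  have pB : p \notin B i.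
    by apply/negP => /(Ei' u p uA); rewrite (negPf (before_asym b1)).
  have qB : q \in B i by rewrite pqB negbK in pB.
  have iI' : i \in I' by rewrite inE iI uA qB pB -uvA uA.
  rewrite (bigD1 i) //= (_ : E i s).
    by rewrite lerDl sumr_ge0 // => j _; apply: ler0n.
  rewrite /E b1 b3 !andbT; apply/precedesP => x y; rewrite !inE.
  have fx : x \in A i -> before x q s by move/Ei'; apply.
  have fy : y \in B i -> before u y s by apply: Ei'.
  case/orP => [/orP[] /eqP->|/andP[_ xA]]; case/orP => [/orP[] /eqP->|/andP[_ yB]] //.
  - exact: before_trans b1 b2.
  - exact: before_trans b1 (before_trans b2 b3).
  - exact: before_trans b1 (fy yB).
  - exact: before_trans b2 b3.
  - exact: fy.
  - exact: fx.
  - exact: before_trans (fx xA) b3.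
  - exact: Ei'.
have upuqv : uniq [:: p; u; q; v].
  by rewrite /= !inE !negb_or pu pq pv uv qv [u == q]eq_sym qu.
by rewrite (expect_increasing4 upuqv); lra.
Qed.

(** By [increasing4_avoids], the order [p < u < q < v] can fail to contribute 1/60 only if the pair
    [({p, u}, {q, v})] is present, and [q < v < p < u] only if [({q, v}, {p, u})] is. Both cannot be
    present, so one of the two orders contributes. Exchanging [p] and [q] gives a second such order,
    incompatible with the first. *)
Lemma avoids_22 I A B i0 :
    one_crossing I A B ->
    {in I, forall i, (2 <= #|A i|)%N} -> {in I, forall i, (2 <= #|B i|)%N} ->
    i0 \in I -> #|A i0| = 2 -> #|B i0| = 2 ->
  1 / 30%:R <= expect (fun s => (avoids I A B s)%:R).
Proof.
move=> oAB sA sB i0I /eqP/cards2P[p [q [pq A0]]] /eqP/cards2P[u [v [uv B0]]].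
pose e p u q v := expect (fun s => (increasing4 p u q v s && avoids I A B s)%:R).
have dich p' q' : A i0 = [set p'; q'] -> p' != q' ->
    exists t : T * T * T * T, t \in [:: (p', u, q', v); (q', v, p', u)] /\
      1 / 60%:R <= e t.1.1.1 t.1.1.2 t.1.2 t.2.
  move=> A0' pq'.
  have good := increasing4_avoids oAB sA sB i0I.
  have A0'' : A i0 = [set q'; p'] by rewrite A0' setUC.
  have B0'' : B i0 = [set v; u] by rewrite B0 setUC.
  case: (boolP [exists i in I, (A i == [set p'; u]) && (B i == [set q'; v])]); last first.
    move=> nex; exists (p', u, q', v); rewrite inE eqxx; split; first by [].
    apply: good => // i iI Ai Bi; case/exists_inP: nex.
    by exists i; rewrite // Ai Bi !eqxx.
  case/exists_inP => i iI /andP[/eqP Ai /eqP Bi].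
  exists (q', v, p', u); rewrite !inE eqxx orbT; split; first by [].
  apply: good => //; rewrite 1?eq_sym // => j jI Aj Bj.
  have [dAB xAB] := oAB.
  have [uB vB] : u \in B i0 /\ v \in B i0 by rewrite B0 set21 set22.
  have pu : p' != u.
    by apply: contraTneq uB => <-; rewrite (disjointFr (dAB _ i0I)) // A0' set21.
  have ij : i != j.
    apply: contraTneq (set21 p' u) => ij; rewrite -Ai ij Aj !inE negb_or pq' /=.
    by apply: contraTneq vB => <-; rewrite (disjointFr (dAB _ i0I)) // A0' set21.
  (* Here [A i] and [B j] would share the two points [p'] and [u]. *)
  by have := xAB i j iI jI ij; rewrite Ai Bj setIid cards2 pu.
have [t [tin te]] := dich p q A0 pq.
have [t' [tin' te']] : exists t' : T * T * T * T, t' \in [:: (q, u, p, v); (p, v, q, u)] /\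
      1 / 60%:R <= e t'.1.1.1 t'.1.1.2 t'.1.2 t'.2.
  by apply: (dich q p _ _); [rewrite A0 setUC | rewrite eq_sym].
have : e t.1.1.1 t.1.1.2 t.1.2 t.2 + e t'.1.1.1 t'.1.1.2 t'.1.2 t'.2 <=
    expect (fun s => (avoids I A B s)%:R).
  rewrite -avgD; apply: le_expect => s _; case: (avoids I A B s); last by rewrite !andbF addr0.
  rewrite !andbT -natrD ler_nat; move: tin tin'; rewrite !inE /increasing4 /before.
  by case/orP => /eqP-> /orP[] /eqP-> /=; clear; lia.
by lra.
Qed.

(** The fork rules out [i0] because [u < y'], and [j0] because [z < u]. Any other [i] has a point
    [a] of [A i] in [{u, v}] and a point [b] of [B i] in [{q, u}]; they are not both [u], so the
    fork puts [b] before [a]. *)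
Lemma avoids_mixed I A B i0 j0 :
    one_crossing I A B -> i0 \in I -> j0 \in I ->
    #|B i0| = 2 -> #|A j0| = 2 -> (2 < #|A i0|)%N -> (2 < #|B j0|)%N ->
  1 / 30%:R <= expect (fun s => (avoids I A B s)%:R).
Proof.
move=> [dAB xAB] i0I j0I cB cA lA lB.
have ij : i0 != j0 by apply: contraTneq lA => ->; rewrite cA.
have notA i x : i \in I -> x \in B i -> x \notin A i.
  by move=> iI xB; rewrite (disjointFl (dAB i iI)).
have notB i x : i \in I -> x \in A i -> x \notin B i.
  by move=> iI xA; rewrite (disjointFr (dAB i iI)).
have ji : j0 != i0 by rewrite eq_sym.
have /eqP/cards1P[u Eu] := xAB j0 i0 j0I i0I ji.
have /eqP/cards1P[y Ey] := xAB i0 j0 i0I j0I ij.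
have /setIP[uA uB] : u \in A j0 :&: B i0 by rewrite Eu set11.
have ABj x : x \in A j0 -> x \in B i0 -> x = u.
  by move=> xA xB; apply/set1P; rewrite -Eu inE xA.
have ABi x : x \in A i0 -> x \in B j0 -> x = y.
  by move=> xA xB; apply/set1P; rewrite -Ey inE xA.
have other (S : {set T}) x : #|S| = 2 -> x \in S -> exists2 w, w != x & S = [set x; w].
  move=> cS xS; move: cS; rewrite (cardsD1 x) xS add1n => -[] /eqP/cards1P[w Sw].
  exists w; last by rewrite -(setD1K xS) Sw.
  by have /setD1P[] : w \in S :\ x by rewrite Sw set11.
have third (S : {set T}) a b : (2 < #|S|)%N -> exists w, [/\ w \in S, w != a & w != b].
  move=> cS; have /card_gt0P[w] : (0 < #|S :\ a :\ b|)%N.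
    move: cS; rewrite (cardsD1 a) (cardsD1 b (S :\ a)).
    by case: (a \in S); case: (b \in S :\ a); case: #|_|.
  by rewrite !inE => /and3P[wb wa wS]; exists w.
have [q qu Aj] := other _ u cA uA; have [v vu Bi] := other _ u cB uB.
(* The third elements, available since the sizes exceed 2, let [y'] and [z] avoid the common point
   [y] of [A i0] and [B j0], and also [q] and [v] respectively; this makes the five points of the
   fork distinct. *)
have [y' [y'A y'y y'q]] := third _ y q lA; have [z [zB zy zv]] := third _ y v lB.
have qA : q \in A j0 by rewrite Aj set22.
have vB : v \in B i0 by rewrite Bi set22.
have hu : uniq [:: q; z; u; v; y'].
  have qz : q != z by apply: contraTneq zB => <-; apply: notB.
  have qv : q != v by apply: contraNneq qu => qv; apply/eqP/ABj; rewrite // qv.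
  have zu : z != u by apply: contraTneq zB => ->; apply: notB.
  have zy' : z != y' by apply: contraNneq zy => zy'; apply/eqP/ABi; rewrite // zy'.
  have uy' : u != y' by apply: contraTneq y'A => <-; apply: notA.
  have vy' : v != y' by apply: contraTneq y'A => <-; apply: notA.
  rewrite /= !inE !negb_or qz qu qv zu zv zy' uy' vy' [q == y']eq_sym y'q.
  by rewrite [u == v]eq_sym vu.
rewrite -(expect_fork hu); apply: le_expect => s _; rewrite ler_nat.
case: (boolP [&& _, _, _ & _]) => // /and4P[b1 b2 b3 b4].
suff -> : avoids I A B s by [].
apply/forall_inP => i iI; apply/negP => /precedesP Ei.
have [ii|ii0] := eqVneq i i0.
  by move: (Ei y' u); rewrite ii y'A uB (negPf (before_asym b4)) => /(_ isT isT).
have [ii|ij0] := eqVneq i j0.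
  by move: (Ei u z); rewrite ii uA zB (negPf (before_asym b2)) => /(_ isT isT).
have /eqP/cards1P[a /setP/(_ a)] := xAB i i0 iI i0I ii0.
have /eqP/cards1P[b /setP/(_ b)] : #|A j0 :&: B i| = 1 by rewrite xAB // eq_sym.
rewrite Aj Bi !inE !eqxx => /andP[/orP b_uq bB] /andP[aA /orP a_uv].
have nqv := before_trans b1 b3.
case: a_uv aA => /eqP-> aA; case: b_uq bB => /eqP-> bB.
- by have := notA i u iI bB; rewrite aA.
- by have := Ei _ _ aA bB; rewrite (negPf (before_asym b1)).
- by have := Ei _ _ aA bB; rewrite (negPf (before_asym b3)).
- by have := Ei _ _ aA bB; rewrite (negPf (before_asym nqv)).
Qed.

(** * Deleting points from the ends of the order *)

(** By [weight_step] the total weight is the average, over [x] uniform in [X], of the weight left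
    after drawing [x] first: pairs with [x] in [A i] are dropped and the other [B i] lose [x]. *)
Lemma sum_weight_front I A B (X : {set T}) (c : rat) :
    {in I, forall i, A i \subset X} -> {in I, forall i, B i \subset X} ->
    {in I, forall i, [disjoint A i & B i]} -> {in I, forall i, B i != set0} ->
    X != set0 ->
    {in X, forall x, \sum_(i in [set i in I | x \notin A i]) weight #|A i| #|B i :\ x| <= c} ->
  \sum_(i in I) weight #|A i| #|B i| <= c.
Proof.
move=> AX BX dAB B0 X0 step.
have cX : 0 < #|X|%:R :> rat by rewrite ltr0n card_gt0.
rewrite -(ler_pM2l cX) mulr_sumr.
rewrite (eq_bigr (fun i => \sum_(x in X | x \notin A i) weight #|A i| #|B i :\ x|)); last first.
  by move=> i iI; rewrite weight_step ?AX ?BX ?dAB ?B0.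
rewrite (exchange_big_dep (mem X)) /=; last by move=> i x _ /andP[].
rewrite mulr_natl -sumr_const; apply: ler_sum => x xX.
apply: le_trans (step x xX); rewrite le_eqVlt; apply/orP; left; apply/eqP.
by apply: eq_bigl => i; rewrite !inE xX.
Qed.

End CrossingSystems.

Lemma one_crossing_sym (T J : finType) (I : {set J}) (A B : J -> {set T}) :
  one_crossing I A B -> one_crossing I B A.
Proof.
by move=> [dAB xAB]; split=> [i|i j] iI; [rewrite disjoint_sym dAB |
  move=> jI ij; rewrite setIC xAB // eq_sym].
Qed.

(** The remaining [A i] do not contain [x], so deleting [x] from [B j] leaves [A i :&: B j]
    unchanged. *)
Lemma one_crossing_front (T J : finType) (I : {set J}) (A B : J -> {set T}) x :
  one_crossing I A B -> one_crossing [set i in I | x \notin A i] A (fun i => B i :\ x).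
Proof.
move=> [dAB xAB]; split=> [i|i j]; rewrite !inE => /andP[iI xi].
  by apply: disjointWr (dAB i iI); rewrite subsetDl.
move=> /andP[jI xj] ij; rewrite -(xAB i j iI jI ij); apply: eq_card => y; rewrite !inE.
by case: eqP => // ->; rewrite (negPf xi).
Qed.

(* Deleting a random point from the front of the order preserves the expected
   weight, and keeps all sizes at least 2 as long as no [B i] has size 2;
   symmetrically at the back. So it is enough to treat systems in which some
   [B i] and some [A j] have size 2. *)
Lemma one_crossing_sum_weight (T J : finType) (X : {set T}) (I : {set J}) (A B : J -> {set T}) :
    {in I, forall i, A i \subset X} -> {in I, forall i, B i \subset X} ->
    one_crossing I A B ->
    {in I, forall i, (2 <= #|A i|)%N} -> {in I, forall i, (2 <= #|B i|)%N} ->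
  \sum_(i in I) weight #|A i| #|B i| <= 29%:R / 30%:R.
Proof.
have [c cE] : exists c : rat, c = 29%:R / 30%:R by exists (29%:R / 30%:R).
rewrite -cE; have [n] := ubnP #|X|; elim: n => // n IHn in X I A B *; rewrite ltnS => leXn AX BX oAB sA sB.
have [->|/set0Pn[k kI]] := eqVneq I set0; first by rewrite big_set0 cE; lra.
have nonempty (S : {set T}) : (2 <= #|S|)%N -> S != set0.
  by move=> cS; rewrite -card_gt0 (leq_trans _ cS).
have X0 : X != set0.
  by apply: contraTneq (AX k kI) => ->; rewrite subset0 nonempty ?(sA k kI).
have ltX x : x \in X -> (#|X :\ x| < n)%N.
  by move=> xX; apply: leq_trans leXn; rewrite [in leqRHS](cardsD1 x) xX.
have [dAB xAB] := oAB.
have [/exists_inP[i0 i0I /eqP cB]|nB] := boolP [exists i in I, #|B i| == 2]; last first.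
  have sB' i : i \in I -> (2 < #|B i|)%N.
    move=> iI; rewrite ltn_neqAle sB // andbT eq_sym.
    by apply: contra nB => h; apply/exists_inP; exists i.
  apply: (sum_weight_front AX BX dAB) => // [i iI|x xX]; first by rewrite nonempty ?sB.
  apply: (IHn (X :\ x) _ A (fun i => B i :\ x)); first exact: ltX.
  - by move=> i; rewrite inE => /andP[iI xi]; rewrite subsetD1 AX.
  - by move=> i; rewrite inE => /andP[iI xi]; rewrite setSD ?BX.
  - exact: one_crossing_front.
  - by move=> i; rewrite inE => /andP[iI _]; apply: sA.
  - move=> i; rewrite inE => /andP[iI _]; have := sB' i iI; rewrite (cardsD1 x).
    by case: (x \in B i) => //; apply: ltnW.
have [/exists_inP[j0 j0I /eqP cA]|nA] := boolP [exists i in I, #|A i| == 2]; last first.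
  have sA' i : i \in I -> (2 < #|A i|)%N.
    move=> iI; rewrite ltn_neqAle sA // andbT eq_sym.
    by apply: contra nA => h; apply/exists_inP; exists i.
  under eq_bigr do rewrite weightC.
  apply: (sum_weight_front BX AX) => // [i iI|i iI|x xX].
  - by rewrite disjoint_sym dAB.
  - by rewrite nonempty ?sA.
  under eq_bigr do rewrite weightC.
  apply: (IHn (X :\ x) _ (fun i => A i :\ x) B); first exact: ltX.
  - by move=> i; rewrite inE => /andP[iI xi]; rewrite setSD ?AX.
  - by move=> i; rewrite inE => /andP[iI xi]; rewrite subsetD1 BX.
  - by apply/one_crossing_sym/one_crossing_front/one_crossing_sym.
  - move=> i; rewrite inE => /andP[iI _]; have := sA' i iI; rewrite (cardsD1 x).
    by case: (x \in A i) => //; apply: ltnW.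
  - by move=> i; rewrite inE => /andP[iI _]; apply: sB.
have := sum_weight_avoids (one_crossing_cross oAB).
(* Both [i0] and [j0] now exist; either one of these pairs has both sizes 2, or they form the mixed
   case. *)
suff : 1 / 30%:R <= expect (fun s => (avoids I A B s)%:R) by move: cE; lra.
have [cAi|nAi] := eqVneq #|A i0| 2; first exact: (avoids_22 oAB sA sB i0I).
have [cBj|nBj] := eqVneq #|B j0| 2; first exact: (avoids_22 oAB sA sB j0I).
apply: (avoids_mixed oAB i0I j0I cB cA).
  by rewrite ltn_neqAle eq_sym nAi sA.
by rewrite ltn_neqAle eq_sym nBj sB.
Qed.

(** * Padding the sets to their prescribed sizes *)

Section Padding.
Variables (T J : finType) (A : J -> {set T}) (a : J -> nat) (K : nat) (c : bool).

(** The added points are fresh and tagged by [i]; the flag [c] separates those added to the [A i]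
    from those added to the [B i], so no new intersection arises. [K] bounds the supply of fresh
    points for each index and flag. *)
Definition padded (i : J) : {set T + J * 'I_K * bool} :=
  inl @: A i :|: [set inr (i, k, c) | k : 'I_K & (k < a i - #|A i|)%N].

Lemma card_padded i : (#|A i| <= a i <= K)%N -> #|padded i| = a i.
Proof.
case/andP=> leA leK; rewrite cardsU.
rewrite (_ : _ :&: _ = set0) ?cards0 ?subn0; last first.
  by apply/setP => x; rewrite !inE; apply/negP => /andP[/imsetP[t _ ->] /imsetP[]].
rewrite !card_imset; last 2 first.
- by move=> k l [].
- by move=> x y [].
rewrite -[RHS](subnKC leA); congr (_ + _)%N.
rewrite -[RHS](card_ord (a i - #|A i|)) -[RHS]sum1_card -[LHS]sum1_card.
rewrite (big_ord_widen K (fun=> 1%N)) //.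
  by apply: eq_bigl => k; rewrite inE.
by rewrite leq_subLR (leq_trans leK) ?leq_addl.
Qed.

End Padding.

Lemma padded_cap (T J : finType) (A B : J -> {set T}) a b K i j :
  padded A a K true i :&: padded B b K false j = inl @: (A i :&: B j).
Proof.
apply/setP => x; rewrite !inE; apply/andP/imsetP.
  case=> /orP[/imsetP[t tA ->]|/imsetP[k _ ->]] /orP[/imsetP[t' tB]|/imsetP[k' _]] //.
  by case=> tt; exists t; rewrite // inE tA tt.
by case=> t; rewrite inE => /andP[tA tB] ->; rewrite !imset_f.
Qed.

Theorem theorem3 (m : nat) (hm : (1 <= m)%N)
  (a b : 'I_m -> nat)
  (ha : forall i : 'I_m, (2 <= a i)%N)
  (hb : forall i : 'I_m, (2 <= b i)%N)
  (T : finType) (A B : 'I_m -> {set T})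
  (hdisj : forall i : 'I_m, A i :&: B i = set0)
  (hcross : forall i j : 'I_m, i <> j -> #|A i :&: B j| = 1%N)
  (hA : forall i : 'I_m, (#|A i| <= a i)%N)
  (hB : forall i : 'I_m, (#|B i| <= b i)%N) :
  (\sum_(i < m) (1 / ('C(a i + b i, a i))%:R) <= 29%:R / 30%:R :> rat)%R.
Proof.
(* Any common upper bound for the [a i] and [b i] would serve. *)
pose K := (\sum_i (a i + b i))%N.
have leK i : (a i + b i <= K)%N by rewrite /K (bigD1 i) //= leq_addr.
pose A' := padded A a K true; pose B' := padded B b K false.
have cA' i : #|A' i| = a i.
  by rewrite card_padded // hA (leq_trans _ (leK i)) ?leq_addr.
have cB' i : #|B' i| = b i.
  by rewrite card_padded // hB (leq_trans _ (leK i)) ?leq_addl.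
have oAB : one_crossing [set: 'I_m] A' B'.
  split=> [i _|i j _ _ /eqP ij].
    by rewrite -setI_eq0 padded_cap hdisj imset0.
  by rewrite padded_cap card_imset ?hcross // => x y [].
have := @one_crossing_sum_weight _ _ setT _ A' B' (fun _ _ => subsetT _) (fun _ _ => subsetT _) oAB.
rewrite (eq_bigl xpredT); last by move=> i; rewrite inE.
rewrite (eq_bigr (fun i => 1 / ('C(a i + b i, a i))%:R)); last first.
  by move=> i _; rewrite cA' cB' div1r.
by apply=> i _; rewrite ?cA' ?cB'.
Qed.
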